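(* There is an absolute constant $C>0$ such that for every integer $n\ge1$ and all reals $0<\varepsilon<1$, $0<\delta<1$ there exists a mergeable cardinality estimation data structure for the universe $[n]$ with relative accuracy $\varepsilon$ and failure probability $\delta$ whose space usage is at most $C\,(\ln(\delta^{-1})\varepsilon^{-2}+\ln n+1)$ bits.
   Context: $[n]:=\{0,\dots,n-1\}$. A mergeable cardinality estimation data structure for $[n]$ with relative accuracy $\varepsilon$ and failure probability $\delta$ consists of: a finite nonempty seed set $\Theta$ (seeds drawn uniformly at random), a set $S$ of sketches together with an injective encoding of sketches as finite bit strings, functions $\mathrm{single}:[n]\times\Theta\to S$, $\mathrm{merge}:S\times S\to S$, $\mathrm{estimate}:S\to\mathbb R$, and a map $\nu$ assigning to each $\theta\in\Theta$ and nonempty $A\subseteq[n]$ a sketch $\nu(\theta,A)\in S$, such that for all $\theta$, $x\in[n]$ and nonempty $A,B\subseteq[n]$: $\mathrm{single}(x,\theta)=\nu(\theta,\{x\})$ and $\mathrm{merge}(\nu(\theta,A),\nu(\theta,B))=\nu(\theta,A\cup B)$; and for every nonempty $A\subseteq[n]$, $\Pr_{\theta\sim U(\Theta)}\big(|\mathrm{estimate}(\nu(\theta,A))-|A||>\varepsilon|A|\big)\le\delta$. Its space usage is $\lceil\log_2|\Theta|\rceil$ plus the maximum, over all $\theta\in\Theta$ and nonempty $A\subseteq[n]$, of the bit length of the encoding of $\nu(\theta,A)$. *)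

(* Defs.v *)
From Stdlib Require Import Reals.
From mathcomp Require Import all_boot.
Set Implicit Arguments. Unset Strict Implicit. Unset Printing Implicit Defensive.

Local Open Scope R_scope.

Record MCE (n : nat) := MkMCE {
  seed : finType;                         (* Theta, seeds drawn uniformly *)
  sketch : Type;
  enc : sketch -> seq bool;
  enc_inj : injective enc;
  single : 'I_n -> seed -> sketch;
  merge : sketch -> sketch -> sketch;
  estimate : sketch -> R;
  nu : seed -> {set 'I_n} -> sketch       (* only used on nonempty A *)
}.

Definition bad_est (x : R) (a : nat) (eps : R) : bool :=
  if Rlt_dec (eps * INR a) (Rabs (x - INR a)) then true else false.

Definition fail_prob n (D : MCE n) (eps : R) (A : {set 'I_n}) : R :=
  (INR #|[set th : seed D | bad_est (estimate (nu th A)) #|A| eps]|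
     / INR #|seed D|)%R.

Definition is_MCE n (D : MCE n) (eps delta : R) : Prop :=
  (0 < #|seed D|)%N /\
  (forall (th : seed D) (x : 'I_n), single x th = nu th [set x]) /\
  (forall (th : seed D) (A B : {set 'I_n}), A != set0 -> B != set0 ->
      merge (nu th A) (nu th B) = nu th (A :|: B)) /\
  (forall A : {set 'I_n}, A != set0 -> (fail_prob D eps A <= delta)%R).

(* Space usage: ceil(log2 |Theta|) + max bit length of nu(theta, A), A nonempty.
   up_log 2 m is the least e with m <= 2^e, i.e. ceil(log2 m) for m >= 1. *)
Definition space n (D : MCE n) : nat :=
  up_log 2 #|seed D| +
  \max_(th : seed D) \max_(A : {set 'I_n} | A != set0) size (enc (nu th A)).

(* Main.v *)
(* Each of [m] independent buckets gives every element of the universe an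
   independent geometric level and keeps the maximal level over [A].  The sketch
   stores these maxima only above the least cutoff [q] for which the unary cost
   [\sum_j (t_j - q)] is below [m]; since this cost is monotone in [A], the
   truncated tables can be merged.  With [a := #|A|], a bucket stays below level
   [r] with probability [(1 - 2^-r)^a], so a Chernoff bound at the boundedly
   many levels [r] with [2^r] comparable to [a] gives relative accuracy [eps]
   once [m] is of order [ln (1 / delta) / eps^2].  The truly random table is
   replaced by one of [O(n / delta)] fixed tables, chosen by the probabilistic
   method so that all [2^n] sets are served.

   When [delta] is close to [1] the budget [ln (1 / delta) / eps^2] is of order
   [p / eps^2] with [p := 1 - delta], which is too small for that sketch.  There
   one uses accuracy of order [eps / p] with failure probability [1 / 2], and
   multiplies the estimate by one of [K], about [1 / (2 p)], random correction
   factors; if [p <= 1 / n] it suffices to guess the cardinality. *)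

Require Import Defs.
From Stdlib Require Import Reals Lra.
From Coquelicot Require Import Rcomplements.
From mathcomp Require Import all_boot Rstruct zify.
Set Implicit Arguments. Unset Strict Implicit. Unset Printing Implicit Defensive.
Local Open Scope R_scope.

Local Notation "\sum_ ( i : T ) F" := (\big[Rplus/0]_(i : T) F) : R_scope.
Local Notation "\prod_ ( i : T ) F" := (\big[Rmult/1]_(i : T) F) : R_scope.

(** * Real inequalities *)

Lemma INR_expn a b : INR (a ^ b)%N = INR a ^ b.
Proof. by elim: b => //= b IH; rewrite expnS mult_INR IH. Qed.

Lemma INR_exp2 k : INR (2 ^ k)%N = 2 ^ k.
Proof. exact: INR_expn. Qed.

Lemma Rinv_INR_ge0 n : 0 <= / INR n.
Proof.
case: n => [|n]; first by rewrite Rinv_0; apply: Rle_refl.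
by apply/Rlt_le/Rinv_0_lt_compat/lt_0_INR; lia.
Qed.

Lemma INR_ge1 n : (0 < n)%N -> 1 <= INR n.
Proof. by move=> n_gt0; rewrite -[1]/(INR 1); apply/le_INR/leP. Qed.

Lemma exp_le x y : x <= y -> exp x <= exp y.
Proof.
by case/Rle_lt_or_eq_dec => [/exp_increasing|->]; [lra | exact: Rle_refl].
Qed.

Lemma exp_mulINR k x : exp (INR k * x) = exp x ^ k.
Proof.
elim: k => [|k IH]; first by rewrite Rmult_0_l exp_0.
by rewrite S_INR Rmult_plus_distr_r Rmult_1_l exp_plus IH Rmult_comm.
Qed.

Lemma exp_le_quadratic y : y <= / 2 -> exp y <= 1 + y + 2 * y ^ 2.
Proof.
move=> y_le; have exp_gt0 := exp_pos y.
have exp_le_inv : exp y * (1 - y) <= 1.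
  have := exp_ineq1_le (- y); rewrite exp_Ropp => inv_ge.
  rewrite -[X in _ <= X](Rinv_r (exp y)); last lra.
  by apply: Rmult_le_compat_l; lra.
have slack_ge0 : 0 <= y ^ 2 * (1 - 2 * y).
  by apply: Rmult_le_pos; [exact: pow2_ge_0 | lra].
by apply: (Rmult_le_reg_r (1 - y)); nra.
Qed.

Lemma ln_le_sub1 x : 0 < x -> ln x <= x - 1.
Proof.
by move=> x_gt0; have := exp_ineq1_le (ln x); rewrite exp_ln //; lra.
Qed.

Lemma bernoulli_ineq y k : 0 <= y <= 1 -> 1 - INR k * y <= (1 - y) ^ k.
Proof.
move=> y01; elim: k => [|k IH]; first by rewrite /=; lra.
rewrite S_INR /=; have k_ge0 := pos_INR k.
have [neg|nonneg] := Rlt_le_dec (1 - INR k * y) 0; last nra.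
have : 0 <= (1 - y) ^ k by apply: pow_le; lra.
nra.
Qed.

Lemma pow_one_sub_le y k : 0 <= y <= 1 -> (1 - y) ^ k <= / (1 + INR k * y).
Proof.
move=> y01; have ky_ge0 : 0 <= INR k * y.
  by apply: Rmult_le_pos; [exact: pos_INR | lra].
apply: (Rle_trans _ (exp (INR k * - y))).
  by rewrite exp_mulINR; apply: pow_incr; have := exp_ineq1_le (- y); lra.
rewrite -Ropp_mult_distr_r exp_Ropp.
by apply: Rinv_le_contravar; [lra | exact: exp_ineq1_le].
Qed.

Lemma ln_lipschitz c x y : 0 < c -> c <= x -> c <= y ->
  Rabs (ln x - ln y) <= Rabs (x - y) / c.
Proof.
move=> c_gt0.
have one_sided u v : c <= u -> c <= v -> ln u - ln v <= Rabs (u - v) / c.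
  move=> cu cv; rewrite -ln_div; [|lra|lra].
  apply: Rle_trans (ln_le_sub1 _) _; first by apply: Rdiv_lt_0_compat; lra.
  apply: (Rle_trans _ (Rabs (u - v) / v)).
    rewrite (_ : u / v - 1 = (u - v) / v); last by field; lra.
    apply: Rmult_le_compat_r; last exact: Rle_abs.
    by apply/Rlt_le/Rinv_0_lt_compat; lra.
  by apply: Rmult_le_compat_l; [exact: Rabs_pos | exact: Rinv_le_contravar].
move=> cx cy; have := one_sided x y cx cy; have := one_sided y x cy cx.
by rewrite Rabs_minus_sym => yx xy; apply: Rabs_le; lra.
Qed.

Lemma log_ratio_error q f a c d : 0 < q < 1 -> 0 < c -> c <= f -> c <= q ^ a ->
  Rabs (f - q ^ a) <= d -> Rabs (ln f / ln q - INR a) <= d / c / (1 - q).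
Proof.
move=> q01 c_gt0 cf cq err.
have lnq : ln q <= - (1 - q) by have := @ln_le_sub1 q; lra.
have -> : ln f / ln q - INR a = (ln f - ln (q ^ a)) / ln q.
  by rewrite ln_pow; [field; lra | lra].
rewrite Rabs_div; last lra.
rewrite (Rabs_left (ln q)); last lra.
have ln_err := ln_lipschitz c_gt0 cf cq.
have {}err : Rabs (f - q ^ a) / c <= d / c.
  by apply: Rmult_le_compat_r => //; apply/Rlt_le/Rinv_0_lt_compat.
apply: Rmult_le_compat; [exact: Rabs_pos | | lra | ].
  by apply/Rlt_le/Rinv_0_lt_compat; lra.
by apply: Rinv_le_contravar; lra.
Qed.

(** * Means over finite uniform spaces *)

Lemma sum_const (T : finType) (c : R) : \sum_(i : T) c = INR #|T| * c.
Proof.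
rewrite big_const -[#|xpredT|]/(#|T|); elim: #|T| => [|k IH].
  by rewrite Rmult_0_l.
by rewrite iterS IH S_INR; ring.
Qed.

Lemma prod_const (T : finType) (c : R) : \prod_(i : T) c = c ^ #|T|.
Proof.
by rewrite big_const -[#|xpredT|]/(#|T|); elim: #|T| => [|k IH] //=; rewrite IH.
Qed.

Lemma sum_le (T : finType) (f g : T -> R) :
  (forall i, f i <= g i) -> \sum_(i : T) f i <= \sum_(i : T) g i.
Proof. by move=> fg; elim/big_ind2: _ => // [|x1 x2 y1 y2]; lra. Qed.

Lemma sum_ge0 (T : finType) (f : T -> R) :
  (forall i, 0 <= f i) -> 0 <= \sum_(i : T) f i.
Proof. by move=> f_ge0; elim/big_ind: _ => // [|x y]; lra. Qed.

Lemma term_le_sum (T : finType) (f : T -> R) i :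
  (forall j, 0 <= f j) -> f i <= \sum_(j : T) f j.
Proof.
move=> f_ge0; rewrite (bigD1 i) //=.
suff : 0 <= \big[Rplus/0]_(j | j != i) f j by lra.
by elim/big_ind: _ => // [|x y]; lra.
Qed.

Lemma sum_indicator (T : finType) (P : pred T) :
  \sum_(w : T) INR (P w) = INR #|[set w | P w]|.
Proof.
rewrite cardsE -sum1_card (big_morph INR plus_INR (erefl _)) [RHS]big_mkcond.
by apply: eq_bigr => w _; rewrite -topredE /=; case: (P w).
Qed.

Lemma prod_indicator (T : finType) (P : pred T) :
  \prod_(i : T) INR (P i) = INR [forall i, P i].
Proof.
case: forallP => [P_all|/forallP].
  by rewrite big1 // => i _; rewrite P_all.
rewrite negb_forall => /existsP[i /negbTE nPi].
by rewrite (bigD1 i) //= nPi Rmult_0_l.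
Qed.

Lemma exp_sum (I : finType) (f : I -> R) :
  exp (\sum_(i : I) f i) = \prod_(i : I) exp (f i).
Proof. exact: (big_morph exp exp_plus exp_0). Qed.

Lemma geometric_sum x n : (x - 1) * (\sum_(k : 'I_n) x ^ k) = x ^ n - 1.
Proof.
elim: n => [|n IH]; first by rewrite big_ord0 /=; ring.
by rewrite big_ord_recr /= Rmult_plus_distr_l IH; ring.
Qed.

Definition mean (T : finType) (f : T -> R) : R := (\sum_(w : T) f w) / INR #|T|.

Definition prob (T : finType) (P : pred T) : R := mean (fun w => INR (P w)).

Section Mean.
Variable T : finType.
Implicit Types (f g : T -> R) (P Q : pred T).

Lemma eq_mean f g : f =1 g -> mean f = mean g.
Proof. by move=> fg; rewrite /mean; congr (_ / _); apply: eq_bigr. Qed.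

Lemma mean_le f g : (forall w, f w <= g w) -> mean f <= mean g.
Proof.
by move=> fg; apply: Rmult_le_compat_r; [exact: Rinv_INR_ge0 | exact: sum_le].
Qed.

Lemma mean_ge0 f : (forall w, 0 <= f w) -> 0 <= mean f.
Proof.
by move=> f_ge0; apply: Rmult_le_pos; [exact: sum_ge0 | exact: Rinv_INR_ge0].
Qed.

Lemma meanD f g : mean (fun w => f w + g w) = mean f + mean g.
Proof. by rewrite /mean big_split /Rdiv Rmult_plus_distr_r. Qed.

Lemma meanZ c f : mean (fun w => c * f w) = c * mean f.
Proof. by rewrite /mean -big_distrr /Rdiv Rmult_assoc. Qed.

Lemma mean_sum (I : finType) (F : I -> T -> R) :
  mean (fun w => \sum_(i : I) F i w) = \sum_(i : I) mean (F i).
Proof. by rewrite /mean /Rdiv exchange_big big_distrl. Qed.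

Lemma card_mul_mean f : INR #|T| * mean f = \sum_(w : T) f w.
Proof.
rewrite /mean; have [T0|T_gt0] := posnP #|T|.
  rewrite T0 Rmult_0_l big_pred0 // => w.
  by have := card0_eq T0 w; rewrite inE.
by field; apply/Rgt_not_eq/lt_0_INR; lia.
Qed.

Lemma eq_prob P Q : P =1 Q -> prob P = prob Q.
Proof. by move=> PQ; apply: eq_mean => w; rewrite PQ. Qed.

Lemma prob_card P : prob P = INR #|[set w | P w]| / INR #|T|.
Proof. by rewrite /prob /mean sum_indicator. Qed.

Lemma prob_ge0 P : 0 <= prob P.
Proof. by apply: mean_ge0 => w; exact: pos_INR. Qed.

Lemma prob_le_mean P f :
  (forall w, 0 <= f w) -> (forall w, P w -> 1 <= f w) -> prob P <= mean f.
Proof.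
move=> f_ge0 f_ge1; apply: mean_le => w.
by case: (boolP (P w)) => [/f_ge1|_] /=.
Qed.

Lemma prob_le P Q : (forall w, P w -> Q w) -> prob P <= prob Q.
Proof.
move=> PQ; apply: prob_le_mean => [w|w /PQ ->]; first exact: pos_INR.
exact: Rle_refl.
Qed.

Lemma prob_pred0 : prob (pred0 : pred T) = 0.
Proof. by rewrite /prob /mean big1 // /Rdiv Rmult_0_l. Qed.

Lemma prob_or P Q : prob (fun w => P w || Q w) <= prob P + prob Q.
Proof.
by rewrite -meanD; apply: mean_le => w; case: (P w); case: (Q w) => /=; lra.
Qed.

Lemma union_bound (I : finType) (F : I -> pred T) b :
  (forall i, prob (F i) <= b) ->
  prob (fun w => [exists i, F i w]) <= INR #|I| * b.
Proof.
move=> Fb; rewrite -sum_const; apply: Rle_trans (sum_le Fb).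
rewrite -mean_sum; apply: prob_le_mean => [w|w /existsP[i Fi]].
  by apply: sum_ge0 => i; exact: pos_INR.
apply: Rle_trans (term_le_sum i (f := fun i => INR (F i w)) _) => [|j].
  by rewrite Fi; exact: Rle_refl.
exact: pos_INR.
Qed.

Hypothesis T_gt0 : (0 < #|T|)%N.

Lemma mean_const c : mean (fun _ : T => c) = c.
Proof. by rewrite /mean sum_const; field; apply/not_0_INR; lia. Qed.

Lemma prob_predT : prob (predT : pred T) = 1.
Proof. exact: mean_const. Qed.

Lemma prob_le1 P : prob P <= 1.
Proof. by rewrite -prob_predT; exact: prob_le. Qed.

Lemma prob_not P : prob (fun w => ~~ P w) = 1 - prob P.
Proof.
have <- : prob P + prob (fun w => ~~ P w) = 1; last by ring.
rewrite -meanD -[RHS]mean_const; apply: eq_mean => w.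
by case: (P w) => /=; ring.
Qed.

Lemma prob_lt1_exists P : prob P < 1 -> exists w, ~~ P w.
Proof.
move=> P_lt1; apply/existsP; rewrite -negb_forall; apply/negP => /forallP P_all.
by move: P_lt1; rewrite (eq_prob (Q := predT)) // prob_predT; lra.
Qed.

Lemma prob_ge_inv_card P w : P w -> / INR #|T| <= prob P.
Proof.
move=> Pw; rewrite prob_card -[X in X <= _]Rmult_1_l.
apply: Rmult_le_compat_r; first exact: Rinv_INR_ge0.
apply: INR_ge1; rewrite card_gt0.
by apply/set0Pn; exists w; rewrite inE.
Qed.

End Mean.

Lemma card_ffun_gt0 (I T : finType) : (0 < #|T|)%N -> (0 < #|{ffun I -> T}|)%N.
Proof. by move=> T_gt0; rewrite card_ffun expn_gt0 T_gt0. Qed.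

Lemma mean_prod (I T : finType) (f : I -> T -> R) :
  mean (fun w : {ffun I -> T} => \prod_(i : I) f i (w i))
  = \prod_(i : I) mean (f i).
Proof.
rewrite /mean /Rdiv -(bigA_distr_bigA (times := Rmult) (plus := Rplus)).
by rewrite big_split /= prod_const card_ffun INR_expn pow_inv.
Qed.

Lemma prob_fst_le (T J : finType) (P : pred (T * J)) (Q : pred T) :
  (0 < #|J|)%N -> (forall x, Q x -> exists j, P (x, j)) ->
  prob Q <= INR #|J| * prob P.
Proof.
move=> J_gt0 QP; rewrite !prob_card card_prod mult_INR.
have J_gt0R : 0 < INR #|J| by apply: lt_0_INR; lia.
have -> : INR #|J| * (INR #|[set w | P w]| / (INR #|T| * INR #|J|))
          = INR #|[set w | P w]| / INR #|T|.
  rewrite /Rdiv Rinv_mult -[RHS]Rmult_1_r -(Rinv_r (INR #|J|)); last lra.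
  by ring.
apply: Rmult_le_compat_r; first exact: Rinv_INR_ge0.
apply/le_INR/leP/leq_trans/(leq_imset_card fst).
apply/subset_leq_card/subsetP => x; rewrite inE => /QP[j Pxj].
by apply/imsetP; exists (x, j); rewrite ?inE.
Qed.

Lemma mean_pow_le (T : finType) (f : T -> nat) x q c :
  (0 < #|T|)%N -> 1 <= x -> 0 <= q -> x * q < 1 -> 0 <= c ->
  (forall k, prob (fun w => k < f w)%N <= c * q ^ k) ->
  mean (fun w => x ^ f w) <= 1 + (x - 1) * c / (1 - x * q).
Proof.
move=> T_gt0 x_ge1 q_ge0 xq_lt1 c_ge0 tail.
pose L := \max_w f w.
have layer_cake w :
    x ^ f w = 1 + (x - 1) * \sum_(k : 'I_L) (x ^ k * INR (k < f w)%N).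
  rewrite -[LHS](Rplus_minus 1) -geometric_sum; congr (_ + _ * _).
  rewrite (big_ord_widen L) ?leq_bigmax // big_mkcond.
  by apply: eq_bigr => k _; case: ifP => _ /=; ring.
rewrite (eq_mean layer_cake) meanD mean_const // meanZ /Rdiv Rmult_assoc.
apply: Rplus_le_compat_l; apply: Rmult_le_compat_l; first lra.
rewrite (mean_sum (fun k w => x ^ nat_of_ord k * INR (k < f w)%N)).
apply: (Rle_trans _ (c * \sum_(k : 'I_L) (x * q) ^ k)).
  rewrite big_distrr; apply: sum_le => k /=; rewrite meanZ Rpow_mult_distr.
  have := Rmult_le_compat_l _ _ _ (pow_le x k ltac:(lra)) (tail k).
  by rewrite /prob; lra.
apply: Rmult_le_compat_l => //; apply: (Rmult_le_reg_r (1 - x * q)); first lra.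
rewrite Rinv_l; last lra.
have := geometric_sum (x * q) L; have := pow_le (x * q) L ltac:(nra); lra.
Qed.

(** * Concentration and derandomization *)

Lemma prob_sum_ge (T I : finType) (X : T -> R) t :
  prob (fun w : {ffun I -> T} => Rle_dec t (\sum_(i : I) X (w i)))
  <= exp (- t) * mean (fun x => exp (X x)) ^ #|I|.
Proof.
apply: (Rle_trans _ (mean (fun w : {ffun I -> T} =>
    exp (- t) * \prod_(i : I) exp (X (w i))))).
  apply: prob_le_mean => w; rewrite -exp_sum -exp_plus.
    exact/Rlt_le/exp_pos.
  by move/sumboolP => t_le; rewrite -exp_0; apply: exp_le; lra.
rewrite meanZ (mean_prod (fun _ x => exp (X x))) prod_const.
exact: Rle_refl.
Qed.

Lemma mean_exp_centered (T : finType) (f : T -> R) : (0 < #|T|)%N ->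
  mean f = 0 -> (forall x, f x <= / 2) ->
  mean (fun x => exp (f x)) <= exp (2 * mean (fun x => f x ^ 2)).
Proof.
move=> T_gt0 f_centered f_le.
apply: (Rle_trans _ (mean (fun x => 1 + f x + 2 * f x ^ 2))).
  by apply: mean_le => x; exact: exp_le_quadratic.
rewrite !meanD meanZ mean_const // f_centered Rplus_0_r.
exact: exp_ineq1_le.
Qed.

Definition freq (T : Type) (I : finType) (P : pred T) (w : {ffun I -> T}) : R :=
  prob (fun i => P (w i)).

Section Chernoff.
Variables (T I : finType) (P : pred T).
Hypothesis T_gt0 : (0 < #|T|)%N.

Lemma mean_exp_indicator l : Rabs l <= / 2 ->
  mean (fun x => exp (l * (INR (P x) - prob P))) <= exp (l ^ 2 / 2).
Proof.
move=> /Rabs_le_between l_le.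
have p01 : 0 <= prob P <= 1.
  by split; [exact: prob_ge0 | exact: prob_le1].
apply: Rle_trans (mean_exp_centered T_gt0 _ _) _ => [|x|].
- by rewrite meanZ meanD mean_const // -/(prob P); ring.
- by case: (P x) => /=; nra.
apply: exp_le.
rewrite (eq_mean (g := fun x =>
  l ^ 2 * prob P ^ 2 + l ^ 2 * (1 - 2 * prob P) * INR (P x))); last first.
  by move=> x; case: (P x) => /=; ring.
rewrite meanD mean_const // meanZ -/(prob P).
have := Rmult_le_pos _ _ (pow2_ge_0 l) (pow2_ge_0 (1 - 2 * prob P)).
lra.
Qed.

Lemma chernoff_one_sided l : Rabs l <= / 2 ->
  prob (fun w : {ffun I -> T} => Rle_dec (l ^ 2) (l * (freq P w - prob P)))
  <= exp (- (INR #|I| * (l ^ 2 / 2))).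
Proof.
move=> l_le.
pose X x := l * (INR (P x) - prob P).
have X_sum (w : {ffun I -> T}) :
    \sum_(i : I) X (w i) = INR #|I| * (l * (freq P w - prob P)).
  rewrite -big_distrr big_split /= sum_const.
  by rewrite -(card_mul_mean (fun i => INR (P (w i)))) /freq /prob /=; ring.
apply: (Rle_trans _ (prob (fun w : {ffun I -> T} =>
    Rle_dec (INR #|I| * l ^ 2) (\sum_(i : I) X (w i))))).
  apply: prob_le => w /sumboolP l_le_dev; apply/sumboolP; rewrite X_sum.
  by apply: Rmult_le_compat_l => //; exact: pos_INR.
apply: Rle_trans (@prob_sum_ge _ I X _) _.
have -> : - (INR #|I| * (l ^ 2 / 2))
          = - (INR #|I| * l ^ 2) + INR #|I| * (l ^ 2 / 2) by field.
rewrite exp_plus exp_mulINR.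
apply: Rmult_le_compat_l; first exact/Rlt_le/exp_pos.
apply: pow_incr; split; last exact: mean_exp_indicator.
by apply: mean_ge0 => x; exact/Rlt_le/exp_pos.
Qed.

Lemma chernoff t : 0 < t <= / 2 ->
  prob (fun w : {ffun I -> T} => Rlt_dec t (Rabs (freq P w - prob P)))
  <= 2 * exp (- (INR #|I| * (t ^ 2 / 2))).
Proof.
move=> t_bnd.
pose dev l (w : {ffun I -> T}) : bool :=
  Rle_dec (l ^ 2) (l * (freq P w - prob P)).
have one_sided l : Rabs l = t ->
    prob (dev l) <= exp (- (INR #|I| * (t ^ 2 / 2))).
  by move=> l_t; rewrite -l_t pow2_abs; apply: chernoff_one_sided; lra.
have up := one_sided t (Rabs_pos_eq t ltac:(lra)).
have down := one_sided (- t) ltac:(rewrite Rabs_Ropp Rabs_pos_eq; lra).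
apply: (Rle_trans _ (prob (fun w => dev t w || dev (- t) w))); last first.
  by apply: Rle_trans (prob_or _ _) _; lra.
apply: prob_le => w /sumboolP t_lt; apply/orP.
have [neg|pos] := Rlt_le_dec (freq P w - prob P) 0.
  by right; apply/sumboolP; move: t_lt; rewrite Rabs_left //; nra.
by left; apply/sumboolP; move: t_lt; rewrite Rabs_pos_eq //; nra.
Qed.

End Chernoff.

Lemma derandomize (T I J : finType) (bad : I -> pred T) d :
  (0 < #|T|)%N -> (forall i, prob (bad i) <= d / 4) ->
  INR #|I| < exp (d * INR #|J| / 2) ->
  exists s : {ffun J -> T}, forall i, freq (bad i) s <= d.
Proof.
move=> T_gt0 bad_le I_lt.
have mgf i : mean (fun x => exp (INR (bad i x))) <= exp (d / 2).
  apply: (Rle_trans _ (mean (fun x => 1 + 2 * INR (bad i x)))).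
    apply: mean_le => x; have := exp_le_3.
    by case: (bad i x); rewrite /= ?exp_0; lra.
  rewrite meanD meanZ mean_const // -/(prob (bad i)).
  by apply: Rle_trans (exp_ineq1_le _); have := bad_le i; lra.
pose often i (s : {ffun J -> T}) : bool :=
  Rle_dec (d * INR #|J|) (\sum_(j : J) INR (bad i (s j))).
have often_le i : prob (often i) <= exp (- (d * INR #|J| / 2)).
  apply: Rle_trans (@prob_sum_ge _ J (fun x => INR (bad i x)) _) _.
  have -> : - (d * INR #|J| / 2) = - (d * INR #|J|) + INR #|J| * (d / 2).
    by field.
  rewrite exp_plus exp_mulINR.
  apply: Rmult_le_compat_l; first exact/Rlt_le/exp_pos.
  by apply: pow_incr; split => //; apply: mean_ge0 => x; exact/Rlt_le/exp_pos.
have [|s] := @prob_lt1_exists _ (card_ffun_gt0 J T_gt0)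
  (fun s => [exists i, often i s]).
  apply: Rle_lt_trans (union_bound often_le) _; rewrite exp_Ropp.
  by apply/Rlt_div_l; [exact: exp_pos | lra].
rewrite negb_exists => /forallP not_often; exists s => i.
have /sumboolP/Rnot_le_lt := not_often i.
rewrite -(card_mul_mean (fun j => INR (bad i (s j)))) -/(prob _) -/(freq _ s).
by move=> lt_d; have := pos_INR #|J|; nra.
Qed.

(** * Truncated tables *)

Definition unary (s : seq nat) : seq bool :=
  flatten [seq rcons (nseq k true) false | k <- s].

Lemma unary_inj : injective unary.
Proof.
elim=> [|k s IH] [|k' s'] //=; try by case: k || case: k'.
rewrite /unary /= !cat_rcons.
elim: k k' => [|k IHk] [|k'] //=; first by case=> /IH ->.
by case=> /IHk [-> ->].
Qed.

Lemma size_unary s : size (unary s) = (sumn s + size s)%N.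
Proof.
elim: s => //= k s IH.
by rewrite /unary /= size_cat size_rcons size_nseq -/(unary s) IH; lia.
Qed.

Section TruncatedTable.
Variable m : nat.
Implicit Types t v : {ffun 'I_m.+1 -> nat}.

Definition excess t (q : nat) : nat := (\sum_(j < m.+1) (t j - q))%N.

Lemma excess_eq0 t q : (forall j, t j <= q)%N -> excess t q = 0%N.
Proof. by move=> t_le; rewrite /excess big1 // => j _; have := t_le j; lia. Qed.

Lemma leq_excess t v q :
  (forall j, t j <= v j)%N -> (excess t q <= excess v q)%N.
Proof. by move=> tv; apply: leq_sum => j _; have := tv j; lia. Qed.

Lemma leq_max_ffun t j : (t j <= \max_i t i)%N.
Proof. exact: (leq_bigmax j). Qed.

Lemma cutoff_exists t : exists q, (excess t q <= m)%N.
Proof.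
by exists (\max_i t i); rewrite excess_eq0 // => j; exact: leq_max_ffun.
Qed.

Definition cutoff t : nat := ex_minn (cutoff_exists t).

Lemma excess_cutoff t : (excess t (cutoff t) <= m)%N.
Proof. by rewrite /cutoff; case: ex_minnP. Qed.

Lemma cutoff_le t q : (excess t q <= m)%N -> (cutoff t <= q)%N.
Proof. by rewrite /cutoff; case: ex_minnP => c _ c_min /c_min. Qed.

Lemma leq_cutoff t v : (forall j, t j <= v j)%N -> (cutoff t <= cutoff v)%N.
Proof.
move=> tv; apply: cutoff_le.
exact: leq_trans (leq_excess _ tv) (excess_cutoff v).
Qed.

Definition pack t : nat * {ffun 'I_m.+1 -> nat} :=
  (cutoff t, [ffun j => t j - cutoff t]%N).

Definition unpack (s : nat * {ffun 'I_m.+1 -> nat}) : {ffun 'I_m.+1 -> nat} :=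
  [ffun j => s.2 j + s.1]%N.

Lemma unpack_pack t j : unpack (pack t) j = maxn (t j) (cutoff t).
Proof. by rewrite !ffunE /=; lia. Qed.

(* As the excess bound [m] is one less than the number of entries, no [q] below
   the floor [c] is feasible for [v], so flooring never lowers the cutoff. *)
Lemma pack_floor t v c : (c <= cutoff t)%N ->
  (forall j, v j = maxn (t j) c) -> pack v = pack t.
Proof.
move=> c_le v_floor.
have excess_eq q : (c <= q)%N -> excess v q = excess t q.
  by move=> cq; apply: eq_bigr => j _; rewrite v_floor; lia.
have c_le_v : (c <= cutoff v)%N.
  rewrite leqNgt; apply/negP => v_lt; have := excess_cutoff v.
  apply/negP; rewrite -ltnNge -[X in (X <= _)%N]card_ord -sum1_card.
  by apply: leq_sum => j _; rewrite v_floor; lia.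
have cutoff_eq : cutoff v = cutoff t.
  apply/eqP; rewrite eqn_leq; apply/andP; split; apply: cutoff_le.
    by rewrite excess_eq // excess_cutoff.
  by rewrite -excess_eq // excess_cutoff.
rewrite /pack cutoff_eq; congr (_, _).
by apply/ffunP => j; rewrite !ffunE v_floor; lia.
Qed.

Definition ffun_max t v : {ffun 'I_m.+1 -> nat} := [ffun j => maxn (t j) (v j)].

Definition merge_packed s s' := pack (ffun_max (unpack s) (unpack s')).

Lemma merge_pack t v : merge_packed (pack t) (pack v) = pack (ffun_max t v).
Proof.
apply: (@pack_floor _ _ (maxn (cutoff t) (cutoff v))) => [|j].
  rewrite geq_max; apply/andP.
  by split; apply: leq_cutoff => j; rewrite ffunE; lia.
by rewrite !(ffunE, unpack_pack) /=; lia.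
Qed.

Definition freq_below t (r : nat) : R := freq (fun k : nat => k < r)%N t.

Lemma freq_below_le t r r' : (r <= r')%N -> freq_below t r <= freq_below t r'.
Proof. by move=> rr'; apply: prob_le => j; lia. Qed.

Lemma freq_below_unpack t r : freq_below (unpack (pack t)) r
  = if (r <= cutoff t)%N then 0 else freq_below t r.
Proof.
have [r_le|r_gt] := leqP r (cutoff t).
  rewrite -(prob_pred0 'I_m.+1).
  by apply: eq_prob => j; rewrite unpack_pack ltnNge leq_max r_le orbT.
by apply: eq_prob => j; rewrite unpack_pack gtn_max r_gt andbT.
Qed.

Lemma est_level_exists t : exists r, Rle_dec (/ 4) (freq_below t r) : bool.
Proof.
exists (\max_i t i).+1; apply/sumboolP.
rewrite (_ : freq_below _ _ = 1); first lra.
rewrite -(@prob_predT 'I_m.+1) ?card_ord //.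
by apply: eq_prob => j; rewrite ltnS leq_max_ffun.
Qed.

Definition est_level t : nat := ex_minn (est_level_exists t).

Lemma freq_below_est_level t : / 4 <= freq_below t (est_level t).
Proof. by rewrite /est_level; case: ex_minnP => r /sumboolP. Qed.

Lemma est_level_le t r : / 4 <= freq_below t r -> (est_level t <= r)%N.
Proof. by rewrite /est_level; case: ex_minnP => c _ c_min /sumboolP /c_min. Qed.

(* Solves [(1 - / 2 ^ r) ^ a = freq_below t r] for [a] at [r := est_level t]. *)
Definition estimator t : R :=
  ln (freq_below t (est_level t)) / ln (1 - / 2 ^ est_level t).

Definition enc_packed (s : nat * {ffun 'I_m.+1 -> nat}) : seq bool :=
  unary (s.1 :: [seq s.2 j | j <- enum 'I_m.+1]).

Lemma enc_packed_inj : injective enc_packed.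
Proof.
move=> [q u] [q' u'] /unary_inj /= [-> /eq_in_map uu']; congr (_, _).
by apply/ffunP => j; apply: uu'; rewrite mem_enum.
Qed.

Lemma size_enc_pack t L : (forall j, t j <= L)%N ->
  (size (enc_packed (pack t)) <= L + 2 * m.+1)%N.
Proof.
move=> t_le; rewrite /enc_packed size_unary /= size_map size_enum_ord.
have -> : sumn [seq [ffun j => t j - cutoff t]%N j | j <- enum 'I_m.+1]
          = excess t (cutoff t).
  by rewrite sumnE big_map big_enum /=; apply: eq_bigr => j _; rewrite ffunE.
have cutoff_L : (cutoff t <= L)%N by apply: cutoff_le; rewrite excess_eq0.
by have := excess_cutoff t; lia.
Qed.

End TruncatedTable.

(** * Accuracy of the estimator *)

(* The expected number of elements of level at least [r] among [a]. *)
Definition load (a r : nat) : R := INR a / 2 ^ r.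

Definition prob_below (a r : nat) : R := (1 - / 2 ^ r) ^ a.

Lemma inv_exp2_bounds r : 0 < / 2 ^ r <= 1.
Proof.
have exp2_ge1 := @pow_R1_Rle 2 r ltac:(lra).
split; first by apply: Rinv_0_lt_compat; lra.
by rewrite -Rinv_1; apply: Rinv_le_contravar; lra.
Qed.

Lemma load_addn a r k : load a r = 2 ^ k * load a (r + k).
Proof.
have exp2_gt0 i : 0 < 2 ^ i by apply: pow_lt; lra.
rewrite /load pow_add; have := exp2_gt0 r; have := exp2_gt0 k.
by move=> k_gt0 r_gt0; field; lra.
Qed.

Lemma load_le a r r' : (r <= r')%N -> load a r' <= load a r.
Proof.
move=> /subnKC <-; rewrite (load_addn a r (r' - r)).
have : 0 <= load a (r + (r' - r)).
  by apply: Rdiv_le_0_compat; [exact: pos_INR | apply: pow_lt; lra].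
by have := @pow_R1_Rle 2 (r' - r) ltac:(lra); nra.
Qed.

Lemma load_up_log a : (0 < a)%N -> / 8 < load a (up_log 2 (4 * a)) <= / 4.
Proof.
move=> a_gt0; set r := up_log 2 (4 * a).
have /andP[lt_a a_le] : (2 ^ r.-1 < 4 * a <= 2 ^ r)%N.
  by apply: up_log_bounds => //; lia.
have r_gt0 : (0 < r)%N by rewrite up_log_gt0; lia.
have {}lt_a : (2 ^ r < 8 * a)%N by rewrite -(prednK r_gt0) expnS; lia.
move/ltP/lt_INR: lt_a; move/leP/le_INR: a_le.
rewrite !mult_INR INR_exp2.
rewrite (_ : INR 4 = 4) 1?(_ : INR 8 = 8); try by rewrite /=; ring.
have exp2_gt0 := pow_lt 2 r ltac:(lra) => a_le lt_a.
by split; [apply/Rlt_div_r | apply/Rle_div_l]; lra.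
Qed.

Lemma prob_below_ge a r : 1 - load a r <= prob_below a r.
Proof. by apply: bernoulli_ineq; have := inv_exp2_bounds r; lra. Qed.

Lemma prob_below_le a r : prob_below a r <= / (1 + load a r).
Proof. by apply: pow_one_sub_le; have := inv_exp2_bounds r; lra. Qed.

Section EstimatorAccuracy.
Variables (m : nat) (t : {ffun 'I_m.+1 -> nat}) (a r0 : nat) (d : R).
Hypothesis load_r0 : / 8 < load a r0 <= / 4.
Hypothesis cutoff_le_r0 : (cutoff t <= r0)%N.
Hypothesis d_le : d <= / 128.
Hypothesis deviation : forall r, (r0 - 5 <= r <= r0.+1)%N ->
  Rabs (freq_below t r - prob_below a r) <= d.

Let r_est := est_level (unpack (pack t)).

Lemma est_level_upper : (r_est <= r0.+1)%N.
Proof.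
apply: est_level_le; rewrite freq_below_unpack leqNgt ltnS cutoff_le_r0 /=.
have /Rabs_le_between := deviation (r := r0.+1) ltac:(lia).
by have := prob_below_ge a r0.+1; have := load_addn a r0 1; rewrite addn1; lra.
Qed.

Lemma cutoff_lt_est_level : (cutoff t < r_est)%N.
Proof.
rewrite ltnNge; apply/negP => r_est_le.
have := freq_below_est_level (unpack (pack t)).
by rewrite freq_below_unpack r_est_le; lra.
Qed.

Lemma quarter_le_freq_below : / 4 <= freq_below t r_est.
Proof.
have := freq_below_est_level (unpack (pack t)).
by rewrite freq_below_unpack leqNgt cutoff_lt_est_level.
Qed.

Lemma est_level_lower : (r0 - 5 <= r_est)%N.
Proof.
rewrite leqNgt; apply/negP => r_est_lt.
have /Rabs_le_between := deviation (r := r0 - 5) ltac:(lia).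
have := Rle_trans _ _ _ quarter_le_freq_below (freq_below_le t (ltnW r_est_lt)).
have load_ge : 4 <= load a (r0 - 5).
  by have := load_addn a (r0 - 5) 5; rewrite subnK /=; [lra | lia].
have : / (1 + load a (r0 - 5)) <= / 5 by apply: Rinv_le_contravar; lra.
by have := prob_below_le a (r0 - 5); lra.
Qed.

Lemma estimator_accurate :
  Rabs (estimator (unpack (pack t)) - INR a) <= 128 * d * INR a.
Proof.
have err := deviation (introT andP (conj est_level_lower est_level_upper)).
have freq_ge := quarter_le_freq_below.
have inv_le : / 2 ^ r_est <= / 2.
  rewrite -(ltn_predK cutoff_lt_est_level) /=.
  apply: Rinv_le_contravar; first lra.
  by have := @pow_R1_Rle 2 r_est.-1 ltac:(lra); lra.
have inv_gt0 := inv_exp2_bounds r_est.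
rewrite /estimator -/r_est freq_below_unpack leqNgt cutoff_lt_est_level /=.
apply: Rle_trans (log_ratio_error (c := / 8) _ _ _ _ err) _; try lra.
  by move/Rabs_le_between: err; rewrite -/(prob_below a r_est); lra.
have load_r_est : / 16 <= load a r_est.
  have := load_le a est_level_upper; have := load_addn a r0 1.
  by rewrite addn1; lra.
have exp2_gt0 := pow_lt 2 r_est ltac:(lra).
have -> : d / / 8 / (1 - (1 - / 2 ^ r_est)) = 8 * (d * 2 ^ r_est) by field; lra.
have -> : 128 * d * INR a = 128 * load a r_est * (d * 2 ^ r_est).
  by rewrite /load; field; lra.
have : 0 <= d * 2 ^ r_est.
  by apply: Rmult_le_pos; [exact: Rle_trans (Rabs_pos _) err | lra].
by move=> d_ge0; apply: Rmult_le_compat_r; lra.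
Qed.

End EstimatorAccuracy.

(** * Random tables *)

Definition level L (w : 'I_(2 ^ L)) : nat := (L - up_log 2 w.+1)%N.

Lemma level_geE L (w : 'I_(2 ^ L)) r : (r <= L)%N ->
  (r <= level w)%N = (w < 2 ^ (L - r))%N.
Proof.
move=> rL; have log_le : (up_log 2 w.+1 <= L)%N by apply: up_log_min.
have -> : (r <= level w)%N = (up_log 2 w.+1 <= L - r)%N by rewrite /level; lia.
apply/idP/idP => [log_le_sub|]; last exact: up_log_min.
by apply: leq_trans (up_logP w.+1 (isT : 1 < 2)%N) _; rewrite leq_pexp2l.
Qed.

Lemma card_ord_exp2_gt0 L : (0 < #|'I_(2 ^ L)|)%N.
Proof. by rewrite card_ord expn_gt0. Qed.

Lemma prob_level_lt L r : (r <= L)%N ->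
  prob (fun w : 'I_(2 ^ L) => (level w < r)%N) = 1 - / 2 ^ r.
Proof.
move=> rL; have sub_le : (2 ^ (L - r) <= 2 ^ L)%N.
  by rewrite leq_pexp2l // leq_subr.
have level_ltE (w : 'I_(2 ^ L)) : (level w < r)%N = ~~ (w < 2 ^ (L - r))%N.
  by rewrite -level_geE // ltnNge.
rewrite (eq_prob level_ltE).
rewrite prob_not ?card_ord_exp2_gt0 // prob_card card_ord.
rewrite -sum1dep_card (big_ord_narrow sub_le) sum1_card card_ord !INR_exp2.
rewrite -{2}(subnK rL) pow_add.
have sub_gt0 := pow_lt 2 (L - r) ltac:(lra).
have r_gt0 := pow_lt 2 r ltac:(lra).
by congr (_ - _); field; lra.
Qed.

Lemma bad_estPn x a eps :
  reflect (Rabs (x - INR a) <= eps * INR a) (~~ bad_est x a eps).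
Proof.
by rewrite /bad_est; case: Rlt_dec => bad_dec /=; constructor; lra.
Qed.

Section RandomTable.
Variables n m L : nat.
Local Notation bucket := {ffun 'I_n -> 'I_(2 ^ L)}.
Local Notation table := {ffun 'I_m.+1 -> bucket}.
Implicit Types A B : {set 'I_n}.

Definition top A (w : bucket) : nat := \max_(x in A) level (w x).

Definition tops (th : table) A : {ffun 'I_m.+1 -> nat} :=
  [ffun j => top A (th j)].

Lemma card_bucket_gt0 : (0 < #|{: bucket}|)%N.
Proof. exact: card_ffun_gt0 (card_ord_exp2_gt0 L). Qed.

Lemma top_le A w : (top A w <= L)%N.
Proof. by apply/bigmax_leqP => x _; exact: leq_subr. Qed.

Lemma topU A B w : top (A :|: B) w = maxn (top A w) (top B w).
Proof.
apply/eqP; rewrite eqn_leq geq_max; apply/and3P; split.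
- apply/bigmax_leqP => x; rewrite inE leq_max => /orP[xA|xB]; apply/orP.
    by left; apply: leq_bigmax_cond.
  by right; apply: leq_bigmax_cond.
- by apply/bigmax_leqP => x xA; apply: leq_bigmax_cond; rewrite inE xA.
- by apply/bigmax_leqP => x xB; apply: leq_bigmax_cond; rewrite inE xB orbT.
Qed.

Lemma topsU th A B : tops th (A :|: B) = ffun_max (tops th A) (tops th B).
Proof. by apply/ffunP => j; rewrite !ffunE topU. Qed.

Lemma top_ltE A w r : A != set0 ->
  (top A w < r)%N = [forall x, (x \in A) ==> (level (w x) < r)%N].
Proof.
case/set0Pn => x0 x0A; apply/idP/forall_inP => [top_lt x xA|lt_r].
  exact: leq_ltn_trans (leq_bigmax_cond _ xA) top_lt.
case: r lt_r => [/(_ x0 x0A)//|r lt_r].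
by rewrite ltnS; apply/bigmax_leqP.
Qed.

Lemma prob_top_lt A r : A != set0 -> (r <= L)%N ->
  prob (fun w => top A w < r)%N = prob_below #|A| r.
Proof.
move=> A0 rL.
pose below_r (x : 'I_n) (y : 'I_(2 ^ L)) := INR ((x \in A) ==> (level y < r)%N).
rewrite /prob.
rewrite (eq_mean (g := fun w : bucket => \prod_(x : 'I_n) below_r x (w x))).
  rewrite mean_prod (eq_bigr (fun x => if x \in A then 1 - / 2 ^ r else 1)).
    by rewrite -big_mkcond big_const /prob_below; elim: #|A| => //= k ->.
  move=> x _; rewrite /below_r; case: (x \in A) => /=.
    exact: prob_level_lt.
  exact/mean_const/card_ord_exp2_gt0.
by move=> w; rewrite prod_indicator top_ltE.
Qed.

Lemma prob_top_ge A r : A != set0 ->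
  prob (fun w => r <= top A w)%N <= load #|A| r.
Proof.
move=> A0; have [rL|Lr] := leqP r L.
  rewrite (eq_prob (Q := fun w => ~~ (top A w < r)%N)); last first.
    by move=> w; rewrite -leqNgt.
  rewrite prob_not; last exact: card_bucket_gt0.
  by rewrite prob_top_lt //; have := prob_below_ge #|A| r; lra.
rewrite (eq_prob (Q := pred0)) ?prob_pred0; last first.
  by move=> w; rewrite leqNgt (leq_ltn_trans (top_le A w) Lr).
by apply: Rdiv_le_0_compat; [exact: pos_INR | apply: pow_lt; lra].
Qed.

Lemma mean_pow_top A q : A != set0 -> load #|A| q <= / 4 ->
  mean (fun w => (3 / 2) ^ (top A w - q)) <= 5 / 4.
Proof.
move=> A0 load_q.
have tail k : prob (fun w => k < top A w - q)%N <= / 8 * (/ 2) ^ k.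
  rewrite (eq_prob (Q := fun w => q + k.+1 <= top A w)%N) => [|w]; last by lia.
  apply: Rle_trans (prob_top_ge _ A0) _.
  have := load_addn #|A| q k.+1; rewrite pow_inv -tech_pow_Rmult => load_eq.
  have k_gt0 := pow_lt 2 k ltac:(lra).
  by apply: (Rmult_le_reg_r (2 ^ k)) => //; rewrite Rmult_assoc Rinv_l; lra.
have := mean_pow_le card_bucket_gt0 (x := 3 / 2) _ _ _ _ tail.
by move=> /(_ ltac:(lra) ltac:(lra) ltac:(lra) ltac:(lra)); lra.
Qed.

Lemma prob_cutoff_gt A q : A != set0 -> load #|A| q <= / 4 ->
  prob (fun th => q < cutoff (tops th A))%N <= (5 / 6) ^ m.+1.
Proof.
move=> A0 load_q.
have exp_ln32 k : exp (INR k * ln (3 / 2)) = (3 / 2) ^ k.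
  by rewrite exp_mulINR exp_ln; lra.
pose X w := INR (top A w - q) * ln (3 / 2).
have X_sum (th : table) :
    \sum_(j : 'I_m.+1) X (th j) = INR (excess (tops th A) q) * ln (3 / 2).
  rewrite /X -big_distrl; congr (_ * _).
  rewrite /excess (big_morph INR plus_INR (erefl (INR 0))).
  by apply: eq_bigr => j _; rewrite ffunE.
apply: (Rle_trans _ (prob (fun th : table =>
    Rle_dec (INR m.+1 * ln (3 / 2)) (\sum_(j : 'I_m.+1) X (th j))))).
  apply: prob_le => th cutoff_gt; apply/sumboolP; rewrite X_sum.
  apply: Rmult_le_compat_r; first by rewrite -ln_1; apply: ln_le; lra.
  apply/le_INR/leP; rewrite ltnNge.
  by apply: contraL cutoff_gt => /cutoff_le; rewrite -leqNgt.
apply: Rle_trans (@prob_sum_ge _ 'I_m.+1 X _) _.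
rewrite exp_Ropp exp_ln32 -pow_inv card_ord -Rpow_mult_distr.
apply: pow_incr; rewrite (eq_mean (fun w => exp_ln32 _)).
have := mean_pow_top A0 load_q.
have : 0 <= mean (fun w => (3 / 2) ^ (top A w - q)).
  by apply: mean_ge0 => w; apply: pow_le; lra.
by move=> mean_ge mean_le; split; [apply: Rmult_le_pos | ]; lra.
Qed.

Definition bad_sketch eps A (th : table) : bool :=
  bad_est (estimator (unpack (pack (tops th A)))) #|A| eps.

Lemma prob_bad_sketch A eps : (8 * n <= 2 ^ L)%N -> 0 < eps < 1 -> A != set0 ->
  prob (bad_sketch eps A) <= 15 * exp (- (INR m.+1 * ((eps / 128) ^ 2 / 2))).
Proof.
move=> n_le eps01 A0; set d := eps / 128; set E := exp _.
have d_bnd : 0 < d <= / 128 by rewrite /d; lra.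
have A_gt0 : (0 < #|A|)%N by rewrite card_gt0.
have A_le : (#|A| <= n)%N by rewrite -[X in (_ <= X)%N]card_ord max_card.
set r0 := up_log 2 (4 * #|A|).
have load_r0 : / 8 < load #|A| r0 <= / 4 by exact: load_up_log.
have r0_lt : (r0 < L)%N.
  by rewrite /r0 -up_logMp //; [apply: up_log_min => // |]; lia.
pose deviates r (th : table) : bool :=
  Rlt_dec d (Rabs (freq (fun w => top A w < r)%N th - prob_below #|A| r)).
apply: (Rle_trans _ (prob (fun th => (r0 < cutoff (tops th A))%N ||
    [exists i : 'I_7, deviates (r0.+1 - i)%N th]))).
  apply: prob_le => th; apply: contraTT.
  rewrite negb_or -leqNgt => /andP[cutoff_le_r0 /existsPn concentrated].
  apply/bad_estPn; rewrite (_ : eps = 128 * d); last by rewrite /d; field.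
  apply: (estimator_accurate load_r0) => // [|r r_bnd]; first lra.
  have i7 : (r0.+1 - r < 7)%N by lia.
  have /sumboolP/Rnot_lt_le := concentrated (Ordinal i7).
  rewrite /= subKn; last lia.
  by congr (Rabs (_ - _) <= _); apply: eq_prob => j; rewrite ffunE.
apply: Rle_trans (prob_or _ _) _.
have cutoff_large : prob (fun th => r0 < cutoff (tops th A))%N <= E.
  apply: Rle_trans (prob_cutoff_gt A0 (proj2 load_r0)) _.
  rewrite /E Ropp_mult_distr_r exp_mulINR; apply: pow_incr.
  by have := exp_ineq1_le (- (d ^ 2 / 2)); nra.
have some_deviates :
    prob (fun th => [exists i : 'I_7, deviates (r0.+1 - i)%N th])
    <= INR #|'I_7| * (2 * E).
  apply: union_bound => i; rewrite /E -[X in INR X](card_ord m.+1).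
  rewrite /deviates -prob_top_lt //; last lia.
  by apply: chernoff; [exact: card_bucket_gt0 | lra].
apply: Rle_trans (Rplus_le_compat _ _ _ _ cutoff_large some_deviates) _.
by rewrite card_ord [INR 7]/=; lra.
Qed.

End RandomTable.

(** * Data structures *)

Lemma card_le_bits (T : finType) :
  (#|T| <= #|{: (up_log 2 #|T|).-tuple bool}|)%N.
Proof. by rewrite card_tuple card_bool up_logP. Qed.

Definition binary (T : finType) (x : T) : seq bool :=
  tval (enum_val (widen_ord (card_le_bits T) (enum_rank x))).

Lemma binary_inj (T : finType) : injective (@binary T).
Proof.
move=> x y /val_inj /enum_val_inj /(congr1 val) /= /val_inj.
exact: enum_rank_inj.
Qed.

Lemma size_binary (T : finType) (x : T) : size (binary x) = up_log 2 #|T|.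
Proof. exact: size_tuple. Qed.

Lemma up_log2_le_ln k : (0 < k)%N -> INR (up_log 2 k) <= 2 * ln (INR k) + 1.
Proof.
case: k => [//|[|k] _]; first by rewrite up_log1 /= ln_1; lra.
have /andP[lt_k _] := up_log_bounds (isT : 1 < 2)%N (isT : 1 < k.+2)%N.
have log_gt0 : (0 < up_log 2 k.+2)%N by rewrite up_log_gt0.
rewrite -(prednK log_gt0) S_INR.
have := pos_INR (up_log 2 k.+2).-1; have := ln_lt_2.
suff : INR (up_log 2 k.+2).-1 * ln 2 <= ln (INR k.+2) by nra.
rewrite -ln_pow; last lra.
apply: ln_le; first by apply: pow_lt; lra.
by rewrite -INR_exp2; apply/le_INR/leP/ltnW.
Qed.

Lemma up_log2_mul a b : (up_log 2 (a * b) <= up_log 2 a + up_log 2 b)%N.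
Proof. by apply: up_log_min => //; rewrite expnD leq_mul // up_logP. Qed.

Section SpaceAndFailure.
Variables (n : nat) (D : MCE n).
Implicit Types (th : seed D) (A : {set 'I_n}).

Lemma space_le b :
  (forall th A, A != set0 -> size (enc (nu th A)) <= b)%N ->
  (space D <= up_log 2 #|seed D| + b)%N.
Proof.
move=> enc_le; rewrite leq_add2l.
by apply/bigmax_leqP => th _; apply/bigmax_leqP => A; exact: enc_le.
Qed.

Lemma size_enc_le_space th A : A != set0 ->
  (up_log 2 #|seed D| + size (enc (nu th A)) <= space D)%N.
Proof.
move=> A0; rewrite leq_add2l (bigD1 th) //= (bigD1 A) //=.
by rewrite !leq_max leqnn.
Qed.

Lemma fail_probE eps A :
  fail_prob D eps A = prob (fun th => bad_est (estimate (nu th A)) #|A| eps).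
Proof. by rewrite prob_card. Qed.

Lemma fail_prob_accurate eps A : (0 < #|seed D|)%N ->
  fail_prob D eps A
  = 1 - prob (fun th => ~~ bad_est (estimate (nu th A)) #|A| eps).
Proof. by move=> seed_gt0; rewrite prob_not // -fail_probE; ring. Qed.

Lemma is_MCE_weaken eps d d' : d <= d' -> is_MCE D eps d -> is_MCE D eps d'.
Proof.
move=> dd' [seed_gt0 [singleE [mergeE fail]]]; do 3!split=> //.
by move=> A /fail; lra.
Qed.

End SpaceAndFailure.

Definition budget (n : nat) (eps delta : R) : R :=
  ln (/ delta) / eps ^ 2 + ln (INR n) + 1.

Definition attainable (C : R) (n : nat) (eps delta : R) : Prop :=
  exists D : MCE n,
    is_MCE D eps delta /\ INR (space D) <= C * budget n eps delta.

Lemma ln_INR_ge0 n : (0 < n)%N -> 0 <= ln (INR n).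
Proof.
by move=> n_gt0; rewrite -ln_1; apply: ln_le; [lra | exact: INR_ge1].
Qed.

Lemma one_sub_le_ln_inv d : 0 < d -> 1 - d <= ln (/ d).
Proof. by move=> d_gt0; rewrite ln_Rinv //; have := ln_le_sub1 d_gt0; lra. Qed.

Lemma ln_inv_div_sqr_ge0 eps d :
  0 < eps -> 0 < d < 1 -> 0 <= ln (/ d) / eps ^ 2.
Proof.
move=> eps_gt0 d01; apply: Rdiv_le_0_compat; last exact: pow_lt.
by have := one_sub_le_ln_inv (proj1 d01); lra.
Qed.

Lemma attainable_le C C' n eps delta : C <= C' ->
  (0 < n)%N -> 0 < eps -> 0 < delta < 1 ->
  attainable C n eps delta -> attainable C' n eps delta.
Proof.
move=> CC' n_gt0 eps_gt0 delta01 [D [D_MCE space_bnd]]; exists D; split=> //.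
apply: Rle_trans space_bnd _; apply: Rmult_le_compat_r => //.
have := ln_inv_div_sqr_ge0 eps_gt0 delta01.
by have := ln_INR_ge0 n_gt0; rewrite /budget; lra.
Qed.

Section SketchMCE.
Variables (n m L : nat) (J : finType).
Variable s : {ffun J -> {ffun 'I_m.+1 -> {ffun 'I_n -> 'I_(2 ^ L)}}}.

Definition sketch_MCE : MCE n :=
  @MkMCE n J (nat * {ffun 'I_m.+1 -> nat})%type
    (@enc_packed m) (@enc_packed_inj m)
    (fun x k => pack (tops (s k) [set x])) (@merge_packed m)
    (fun v => estimator (unpack v)) (fun k A => pack (tops (s k) A)).

Lemma space_sketch_MCE : (space sketch_MCE <= up_log 2 #|J| + (L + 2 * m.+1))%N.
Proof.
by apply: space_le => k A _; apply: size_enc_pack => j; rewrite ffunE top_le.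
Qed.

Lemma is_MCE_sketch_MCE eps delta : (0 < #|J|)%N ->
  (forall A, A != set0 -> freq (bad_sketch eps A) s <= delta) ->
  is_MCE sketch_MCE eps delta.
Proof.
move=> J_gt0 freq_le; do 2!split=> //; split=> [k A B _ _|A A0].
  by rewrite /= merge_pack topsU.
by rewrite fail_probE; exact: freq_le.
Qed.

End SketchMCE.

Lemma sketch_MCE_exists n m L N eps delta :
  (8 * n <= 2 ^ L)%N -> 0 < eps < 1 -> 2 * INR n < delta * INR N.+1 ->
  60 * exp (- (INR m.+1 * ((eps / 128) ^ 2 / 2))) <= delta ->
  exists D : MCE n, is_MCE D eps delta /\
    (space D <= up_log 2 N.+1 + (L + 2 * m.+1))%N.
Proof.
move=> n_le eps01 N_gt exp_le_delta.
pose T := {ffun 'I_m.+1 -> {ffun 'I_n -> 'I_(2 ^ L)}}.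
pose bad (A : {set 'I_n}) (th : T) := (A != set0) && bad_sketch eps A th.
have bad_le A : prob (bad A) <= delta / 4.
  have [->|A0] := eqVneq A set0.
    rewrite (eq_prob (Q := pred0)) ?prob_pred0 => [|th]; last first.
      by rewrite /bad eqxx.
    by have := exp_pos (- (INR m.+1 * ((eps / 128) ^ 2 / 2))); lra.
  rewrite (eq_prob (Q := bad_sketch eps A)) => [|th]; last by rewrite /bad A0.
  by have := @prob_bad_sketch n m L A eps n_le eps01 A0; lra.
have sets_lt : INR #|{: {set 'I_n}}| < exp (delta * INR #|'I_N.+1| / 2).
  rewrite -cardsT -powersetT card_powerset cardsT !card_ord INR_exp2.
  apply: (Rle_lt_trans _ (exp (INR n))); last by apply: exp_increasing; lra.
  rewrite -(Rmult_1_r (INR n)) exp_mulINR; apply: pow_incr.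
  by have := exp_ineq1_le 1; lra.
have T_gt0 := card_ffun_gt0 'I_m.+1 (card_bucket_gt0 n L).
have [s freq_le] := derandomize T_gt0 bad_le sets_lt.
exists (sketch_MCE s); split; last first.
  by have := space_sketch_MCE s; rewrite card_ord.
apply: is_MCE_sketch_MCE => [|A A0]; first by rewrite card_ord.
apply: Rle_trans (freq_le A); apply: prob_le => k.
by rewrite /bad A0.
Qed.

Lemma seed_count_exists n delta : (0 < n)%N -> 0 < delta < 1 ->
  exists N, 2 * INR n < delta * INR N.+1 /\
    INR (up_log 2 N.+1) <= 2 * (ln (INR n) + ln (/ delta)) + 5.
Proof.
move=> n_gt0 delta01.
have n_ge1 := INR_ge1 n_gt0.
have inv_gt1 : 1 < / delta by rewrite -Rinv_1; apply: Rinv_lt_contravar; lra.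
have [|N N_bnd] := nfloor_ex (2 * INR n * / delta); first nra.
exists N; rewrite S_INR; split.
  by rewrite [X in _ < X]Rmult_comm; apply/Rlt_div_l; rewrite /Rdiv; lra.
apply: Rle_trans (up_log2_le_ln _) _ => //.
have : ln (INR N.+1) <= ln (3 * INR n * / delta).
  by apply: ln_le; rewrite S_INR; [have := pos_INR N; lra | nra].
by rewrite !ln_mult; try lra; have := @ln_le_sub1 3 ltac:(lra); lra.
Qed.

Lemma bucket_count_exists eps delta : 0 < eps < 1 -> 0 < delta <= / 2 ->
  exists m, 60 * exp (- (INR m.+1 * ((eps / 128) ^ 2 / 2))) <= delta /\
    INR m.+1 <= 4000000 * (ln (/ delta) / eps ^ 2).
Proof.
move=> eps01 delta_bnd; set D := ln (/ delta).
have D_ge : / 2 <= D.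
  by have := @one_sub_le_ln_inv delta ltac:(lra); rewrite -/D; lra.
have ln60 : 0 < ln 60 <= 59.
  split; last by have := @ln_le_sub1 60; lra.
  by rewrite -ln_1; apply: ln_increasing; lra.
have eps2 : 0 < eps ^ 2 <= 1 by nra.
have DE_ge : / 2 <= D / eps ^ 2 by apply/Rle_div_r; lra.
pose x := 32768 * (ln 60 + D) / eps ^ 2.
have x_gt0 : 0 < x by apply: Rdiv_lt_0_compat; lra.
have [m m_bnd] := nfloor_ex _ (Rlt_le _ _ x_gt0).
exists m; rewrite S_INR; split.
  have -> : delta = 60 * exp (- (ln 60 + D)).
    by rewrite /D ln_Rinv ?Ropp_plus_distr ?exp_plus ?Ropp_involutive
       ?exp_Ropp ?exp_ln; try lra; field.
  apply/Rmult_le_compat_l/exp_le/Ropp_le_contravar; first lra.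
  have -> : ln 60 + D = x * ((eps / 128) ^ 2 / 2) by rewrite /x; field; lra.
  by apply: Rmult_le_compat_r; nra.
have : x <= 3899392 * (D / eps ^ 2); last by lra.
have -> : 3899392 * (D / eps ^ 2) = 3899392 * D / eps ^ 2 by field; lra.
apply: Rmult_le_compat_r; last lra.
by apply/Rlt_le/Rinv_0_lt_compat; lra.
Qed.

Lemma attainable_small_failure : exists C, 0 < C /\
  forall n eps delta, (0 < n)%N -> 0 < eps < 1 -> 0 < delta <= / 2 ->
  attainable C n eps delta.
Proof.
exists 9000000; split; first lra.
move=> n eps delta n_gt0 eps01 delta_bnd.
have [N [N_gt seed_cost]] := @seed_count_exists n delta n_gt0 ltac:(lra).
have [m [m_large bucket_cost]] := bucket_count_exists eps01 delta_bnd.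
have n_le : (8 * n <= 2 ^ (up_log 2 n + 3))%N.
  by rewrite expnD mulnC leq_mul2r up_logP.
have [D [D_MCE space_bnd]] := sketch_MCE_exists n_le eps01 N_gt m_large.
exists D; split=> //; move/leP/le_INR: space_bnd => /Rle_trans; apply.
have D_ge := @one_sub_le_ln_inv delta ltac:(lra).
have eps2 : 0 < eps ^ 2 <= 1 by nra.
have D_le : ln (/ delta) <= ln (/ delta) / eps ^ 2.
  by apply/Rle_div_r; nra.
have := up_log2_le_ln n_gt0; have := ln_INR_ge0 n_gt0.
rewrite /budget (plus_INR (up_log 2 N.+1)) (plus_INR (up_log 2 n + 3)) plus_INR.
rewrite (mult_INR 2) (_ : INR 3 = 3) 1?(_ : INR 2 = 2); try by rewrite /=; ring.
lra.
Qed.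

Section GuessMCE.
Variables (n : nat) (eps : R).

Definition guess_MCE : MCE n :=
  @MkMCE n 'I_n 'I_n (@binary _) (@binary_inj _) (fun _ k => k) (fun k _ => k)
    (fun k => INR k.+1) (fun k _ => k).

Lemma space_guess_MCE : (space guess_MCE <= 2 * up_log 2 n)%N.
Proof.
rewrite mul2n -addnn -[X in (_ <= up_log 2 X + _)%N]card_ord.
by apply: space_le => k A _; rewrite /= size_binary card_ord.
Qed.

Lemma is_MCE_guess_MCE : (0 < n)%N -> 0 < eps ->
  is_MCE guess_MCE eps (1 - / INR n).
Proof.
move=> n_gt0 eps_gt0.
have seed_gt0 : (0 < #|seed guess_MCE|)%N by rewrite card_ord.
do 3!split=> //; move=> A; rewrite -card_gt0 => A_gt0.
have pred_lt : (#|A|.-1 < n)%N.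
  by rewrite prednK // -[X in (_ <= X)%N]card_ord max_card.
rewrite fail_prob_accurate // -[X in / INR X]card_ord.
apply/Rplus_le_compat_l/Ropp_le_contravar.
apply: (prob_ge_inv_card (w := Ordinal pred_lt)); apply/bad_estPn.
rewrite -[estimate _]/(INR #|A|.-1.+1) prednK // Rminus_diag Rabs_R0.
by apply: Rmult_le_pos; [lra | exact: pos_INR].
Qed.

End GuessMCE.

(* The points [1 - e + k * (eps / 2)] form a grid around [1] that is fine enough
   for accuracy [eps] and covers all relative errors of size [e]. *)
Definition correction (e eps : R) (k : nat) : R := 1 - e + INR k * (eps / 2).

Lemma correction_hits e eps K a y : 0 < e <= / 2 -> 0 < eps ->
  8 * e <= INR K * eps -> (0 < a)%N -> Rabs (y - INR a) <= e * INR a ->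
  exists2 k, (k < K)%N & Rabs (y * correction e eps k - INR a) <= eps * INR a.
Proof.
move=> e_bnd eps_gt0 e_le a_gt0 /Rabs_le_between y_bnd.
have a_gt0R : 0 < INR a by apply: lt_0_INR; lia.
have [y_gt0 y_le] : 0 < y /\ y <= 2 * INR a by nra.
pose target := INR a / y.
have targetE : target * y = INR a by rewrite /target; field; lra.
have target_ge : 1 - e <= target by apply/Rle_div_r; nra.
have target_le : target <= 1 + 2 * e by apply/Rle_div_l; nra.
have [|k k_bnd] := nfloor_ex ((target - (1 - e)) / (eps / 2)).
  by apply: Rdiv_le_0_compat; lra.
have {k_bnd} [k_le k_gt] :
    INR k * (eps / 2) <= target - (1 - e) < (INR k + 1) * (eps / 2).
  by split; [apply/Rle_div_r | apply/Rlt_div_l]; lra.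
exists k.
  by apply/ltP/INR_lt/(Rmult_lt_reg_r (eps / 2)); lra.
rewrite -{1}targetE.
rewrite (_ : _ - _ = (correction e eps k - target) * y); last by ring.
rewrite Rabs_mult (Rabs_pos_eq y); last lra.
have : Rabs (correction e eps k - target) <= eps / 2.
  by apply: Rabs_le; rewrite /correction; lra.
by move/(Rmult_le_compat_r _ _ _ (Rlt_le _ _ y_gt0)) => err_le; nra.
Qed.

Section RefinedMCE.
Variables (n : nat) (D0 : MCE n) (K : nat) (e eps : R).

Definition refined_enc (v : sketch D0 * 'I_K) : seq bool :=
  binary v.2 ++ enc v.1.

Lemma refined_enc_inj : injective refined_enc.
Proof.
move=> [v i] [v' i'] /eqP; rewrite eqseq_cat ?size_binary //.
move=> /andP[/eqP ii' /eqP vv'].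
by congr (_, _); [exact: enc_inj vv' | exact: binary_inj ii'].
Qed.

Definition refined_MCE : MCE n :=
  @MkMCE n (seed D0 * 'I_K)%type (sketch D0 * 'I_K)%type
    refined_enc refined_enc_inj
    (fun x th => (single x th.1, th.2)) (fun v v' => (Defs.merge v.1 v'.1, v.2))
    (fun v => estimate v.1 * correction e eps v.2)
    (fun th A => (nu th.1 A, th.2)).

Lemma card_seed_refined_MCE : #|seed refined_MCE| = (#|seed D0| * K)%N.
Proof. by rewrite -[in RHS](card_ord K) -card_prod. Qed.

Lemma space_refined_MCE : (space refined_MCE <= space D0 + 2 * up_log 2 K)%N.
Proof.
have seed_le : (up_log 2 #|seed D0| <= space D0)%N by rewrite leq_addr.
pose b := (space D0 - up_log 2 #|seed D0| + up_log 2 K)%N.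
apply: leq_trans (space_le (b := b) _) _.
  move=> [th i] A A0; rewrite size_cat size_binary card_ord addnC leq_add2r.
  by rewrite -(leq_add2l (up_log 2 #|seed D0|)) subnKC // size_enc_le_space.
rewrite card_seed_refined_MCE.
apply: leq_trans (leq_add (up_log2_mul _ _) (leqnn _)) _.
by rewrite addnACA subnKC // mul2n addnn.
Qed.

Lemma is_MCE_refined_MCE delta : (0 < K)%N -> 0 < e <= / 2 -> 0 < eps ->
  8 * e <= INR K * eps -> is_MCE D0 e delta ->
  is_MCE refined_MCE eps (1 - (1 - delta) / INR K).
Proof.
move=> K_gt0 e_bnd eps_gt0 e_le [seed_gt0 [singleE [mergeE fail]]].
have K_gt0R : 0 < INR K by apply: lt_0_INR; lia.
have refined_seed_gt0 : (0 < #|seed refined_MCE|)%N.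
  by rewrite card_seed_refined_MCE muln_gt0 seed_gt0.
split=> //; split=> [[th i] x|]; first by rewrite /= singleE.
split=> [[th i] A B A0 B0|A A0]; first by rewrite /= mergeE.
have := fail A A0; rewrite !fail_prob_accurate //.
set p0 := prob _; set p := prob _ => fail0.
suff : p0 <= INR K * p.
  move=> p0_le; suff : (1 - delta) / INR K <= p by lra.
  by apply/Rle_div_l => //; lra.
rewrite -{1}(card_ord K); apply: prob_fst_le => [|th /bad_estPn accurate].
  by rewrite card_ord.
have A_gt0 : (0 < #|A|)%N by rewrite card_gt0.
have [k kK hit] := correction_hits e_bnd eps_gt0 e_le A_gt0 accurate.
by exists (Ordinal kK); apply/bad_estPn.
Qed.

End RefinedMCE.

Lemma attainable_guess n eps delta : (0 < n)%N -> 0 < eps -> 0 < delta < 1 ->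
  INR n * (1 - delta) <= 1 -> attainable 4 n eps delta.
Proof.
move=> n_gt0 eps_gt0 delta01 np_le1.
have n_gt0R : 0 < INR n by apply: lt_0_INR; lia.
exists (guess_MCE n); split.
  apply: is_MCE_weaken (is_MCE_guess_MCE n_gt0 eps_gt0).
  suff : 1 - delta <= / INR n by lra.
  by rewrite -[/ _]Rmult_1_l; apply/Rle_div_r; lra.
have /leP/le_INR := space_guess_MCE n; rewrite (mult_INR 2) (_ : INR 2 = 2) //.
have := ln_inv_div_sqr_ge0 eps_gt0 delta01.
by have := up_log2_le_ln n_gt0; have := ln_INR_ge0 n_gt0; rewrite /budget; lra.
Qed.

Lemma budget_coarse n eps delta K : (0 < n)%N -> 0 < eps -> 0 < delta < 1 ->
  1 <= 4 * (INR K * (1 - delta)) ->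
  budget n (Rmin (/ 2) (INR K * eps / 8)) (/ 2) <= 1024 * budget n eps delta.
Proof.
move=> n_gt0 eps_gt0 delta01 Kp_ge.
set p := 1 - delta in Kp_ge; set e := Rmin _ _.
have K_gt0 : 0 < INR K by rewrite /p in Kp_ge; nra.
have eps2_gt0 : 0 < eps ^ 2 by apply: pow_lt.
have p_le : p / eps ^ 2 <= ln (/ delta) / eps ^ 2.
  apply: Rmult_le_compat_r; first exact/Rlt_le/Rinv_0_lt_compat.
  by apply: one_sub_le_ln_inv; lra.
have p_ge0 : 0 <= p / eps ^ 2 by apply: Rdiv_le_0_compat; rewrite // /p; lra.
have inv_e2 : / e ^ 2 <= 4 + 1024 * (p / eps ^ 2).
  rewrite /e /Rmin; case: Rle_dec => _.
    by rewrite (_ : / (/ 2) ^ 2 = 4); [lra | field].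
  have -> : / (INR K * eps / 8) ^ 2 = 64 * (/ INR K ^ 2 / eps ^ 2).
    by field; lra.
  suff : / INR K ^ 2 / eps ^ 2 <= 16 * (p / eps ^ 2) by lra.
  rewrite -Rmult_assoc.
  apply: Rmult_le_compat_r; first exact/Rlt_le/Rinv_0_lt_compat.
  rewrite -[/ _]Rmult_1_l; apply/Rle_div_l; first exact: pow_lt.
  by rewrite /p in Kp_ge *; nra.
have ln2_le : ln (/ / 2) / e ^ 2 <= / e ^ 2.
  rewrite Rinv_inv -[X in _ <= X]Rmult_1_l; apply: Rmult_le_compat_r.
    by apply/Rlt_le/Rinv_0_lt_compat/pow_lt/Rmin_glb_lt; nra.
  by have := @ln_le_sub1 2; lra.
by have := ln_INR_ge0 n_gt0; rewrite /budget; lra.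
Qed.

Lemma attainable_refine C n eps delta : 0 < C -> (0 < n)%N -> 0 < eps < 1 ->
  / 2 < delta < 1 -> 1 < INR n * (1 - delta) ->
  (forall e, 0 < e < 1 -> attainable C n e (/ 2)) ->
  attainable (1024 * C + 4) n eps delta.
Proof.
move=> C_gt0 n_gt0 eps01 delta_bnd np_gt1 coarse; set p := 1 - delta in np_gt1.
have p_bnd : 0 < p < / 2 by rewrite /p; lra.
have inv_2p : / (2 * p) * p = / 2 by field; lra.
have [|K K_bnd] := nfloor_ex (/ (2 * p)).
  by apply/Rlt_le/Rinv_0_lt_compat; lra.
have K_gt0 : (0 < K)%N by case: K K_bnd => //=; nra.
have K_ge1 := INR_ge1 K_gt0.
have Kp_le : INR K * p <= / 2 by nra.
have Kp_ge : 1 <= 4 * (INR K * p) by nra.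
set e := Rmin (/ 2) (INR K * eps / 8).
have Keps_gt0 : 0 < INR K * eps by nra.
have e_bnd : 0 < e <= / 2 by split; [apply: Rmin_glb_lt; lra | exact: Rmin_l].
have e_le : 8 * e <= INR K * eps.
  by have := Rmin_r (/ 2) (INR K * eps / 8); rewrite -/e; lra.
have [D0 [D0_MCE space0]] := coarse e ltac:(lra).
exists (refined_MCE D0 K e eps); split.
  apply: is_MCE_weaken; last first.
    exact: is_MCE_refined_MCE K_gt0 e_bnd (proj1 eps01) e_le D0_MCE.
  suff : p <= (1 - / 2) / INR K by rewrite /p; lra.
  by apply/Rle_div_r; lra.
have /leP/le_INR := space_refined_MCE D0 K e eps.
rewrite (plus_INR (space D0)) (mult_INR 2) (_ : INR 2 = 2) // => space_bnd.
have {}space0 : INR (space D0) <= C * (1024 * budget n eps delta).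
  apply: Rle_trans space0 _; apply: Rmult_le_compat_l; first lra.
  by apply: budget_coarse => //; lra.
have ln_K : ln (INR K) <= ln (INR n) by apply: ln_le; nra.
have accuracy_cost_ge0 := @ln_inv_div_sqr_ge0 eps delta ltac:(lra) ltac:(lra).
have : 2 * INR (up_log 2 K) <= 4 * budget n eps delta.
  have := up_log2_le_ln K_gt0; have := ln_INR_ge0 n_gt0.
  by rewrite /budget; lra.
lra.
Qed.

Lemma attainable_large_failure : exists C, 0 < C /\
  forall n eps delta, (0 < n)%N -> 0 < eps < 1 -> / 2 < delta < 1 ->
  attainable C n eps delta.
Proof.
have [C [C_gt0 small]] := attainable_small_failure.
exists (1024 * C + 4); split; first lra.
move=> n eps delta n_gt0 eps01 delta_bnd.
have [np_le1|np_gt1] := Rle_lt_dec (INR n * (1 - delta)) 1.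
  apply: (@attainable_le 4) => //; [lra | lra | lra |].
  by apply: attainable_guess => //; lra.
apply: attainable_refine => // e e01.
by apply: small => //; lra.
Qed.

Theorem theorem16 :
  exists C : R, (0 < C)%R /\
    forall (n : nat) (eps delta : R),
      (1 <= n)%nat -> (0 < eps < 1)%R -> (0 < delta < 1)%R ->
      exists D : MCE n,
        is_MCE D eps delta /\
        (INR (space D) <= C * (ln (/ delta) / (eps ^ 2) + ln (INR n) + 1))%R.
Proof.
have [C1 [C1_gt0 small]] := attainable_small_failure.
have [C2 [C2_gt0 large]] := attainable_large_failure.
exists (C1 + C2); split=> [|n eps delta n_gt0 eps01 delta01]; first lra.
rewrite -/(attainable (C1 + C2) n eps delta).
have [delta_le|delta_gt] := Rle_lt_dec delta (/ 2).
  by apply: (@attainable_le C1) => //; [lra | lra | apply: small => //; lra].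
by apply: (@attainable_le C2) => //; [lra | lra | apply: large => //; lra].
Qed.
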